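(* Let $n\in\mathbb{N}$ and let $(G,v)$ be a $\mathbb{T}^{(\infty,n)}$-algebra (a weak $(\infty,n)$-category), with $v:T^n(G)\to G$. Let $\lambda^n_G:G\to T^n(G)$ be the unit, and let $\star^m_p$, $1^p_m$, $j^m_p$ be the compositions, reflexors and reversors of the $(\infty,n)$-magma $M^n(G)$ underlying the free $(\infty,n)$-categorical stretching on $G$, whose underlying $\infty$-graph is $T^n(G)$. Define on $G$: - $a\circ^m_pb:=v_m(\lambda^n_G(a)\star^m_p\lambda^n_G(b))$ for $0\le p<m$ and $a,b\in G(m)$ with $s^m_p(a)=t^m_p(b)$; - $\iota^p_m(a):=v_m(1^p_m(\lambda^n_G(a)))$ for $0\le p<m$ and $a\in G(p)$; - $i^m_p(a):=v_m(j^m_p(\lambda^n_G(a)))$ for $n\le p<m$ and $a\in G(m)$. Then $G$ with the compositions $\circ^m_p$, the reflexors $\iota^p_m$ and the reversors $i^m_p$ is an $(\infty,n)$-magma, and $v:T^n(G)\to G$ is a morphism of $(\infty,n)$-magmas from $M^n(G)$ to $G$ with this structure.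
   Context: **$\infty$-graphs.** An $\infty$-graph (globular set) $X$ consists of sets $X(m)=X_m$ ($m\in\mathbb{N}$), whose elements are called $m$-cells, and maps $s^{m+1}_m,t^{m+1}_m:X(m+1)\to X(m)$ with $s^{m}_{m-1}s^{m+1}_m=s^{m}_{m-1}t^{m+1}_m$ and $t^{m}_{m-1}t^{m+1}_m=t^{m}_{m-1}s^{m+1}_m$. For $p<m$, $s^m_p$ and $t^m_p$ denote the iterated sources and targets. Morphisms are maps commuting with sources and targets; the category is $\infty\text{-}\mathbb{G}\mathrm{r}$. **Reflexive $\infty$-graphs.** An $\infty$-graph with maps (reflexors) $1^m_{m+1}:X(m)\to X(m+1)$ with $s^{m+1}_m1^m_{m+1}=t^{m+1}_m1^m_{m+1}=\mathrm{id}$; put $1^p_m=1^{m-1}_m\circ\cdots\circ 1^p_{p+1}$ for $p<m$. **$(\infty,n)$-reversible structure** on an $\infty$-graph $X$: maps (reversors) $j^m_p:X_m\to X_m$ for $n\le p<m$ such that $s^{p+1}_pj^{p+1}_p=t^{p+1}_p$, $t^{p+1}_pj^{p+1}_p=s^{p+1}_p$, and for $m\ge p+2$, $s^m_{m-1}j^m_p=j^{m-1}_ps^m_{m-1}$ and $t^m_{m-1}j^m_p=j^{m-1}_pt^m_{m-1}$. **$\infty$-magmas.** A reflexive $\infty$-graph $M$ with composition maps $\circ^m_p$ ($0\le p<m$) sending each pair $(y,x)\in M(m)\times M(m)$ with $s^m_p(y)=t^m_p(x)$ to $y\circ^m_px\in M(m)$, subject only to the positional axioms: for $p<q<m$, $s^m_q(y\circ^m_px)=s^m_q(y)\circ^q_ps^m_q(x)$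 and $t^m_q(y\circ^m_px)=t^m_q(y)\circ^q_pt^m_q(x)$; for $q\le p$, $s^m_q(y\circ^m_px)=s^m_q(x)$ and $t^m_q(y\circ^m_px)=t^m_q(y)$. Morphisms preserve reflexors and compositions. An $(\infty,n)$-magma is an $\infty$-magma whose underlying $\infty$-graph is equipped with an $(\infty,n)$-reversible structure (no compatibility with the reflexors or compositions is required); morphisms are morphisms of $\infty$-magmas that also commute with the reversors. **Strict $(\infty,n)$-categories.** A strict $\infty$-category is an $\infty$-magma in which the compositions are associative, unital ($x\circ^m_p1^p_m(s^m_p(x))=x=1^p_m(t^m_p(x))\circ^m_px$), satisfy the interchange laws, and $1^p_m(y\circ^p_qx)=1^p_m(y)\circ^m_q1^p_m(x)$ for $q<p<m$. A strict $(\infty,n)$-category is a strict $\infty$-category in which, for all $n\le p<m$, every $m$-cell $\alpha$ has a $\circ^m_p$-inverse $\beta$: $\alpha\circ^m_p\beta=1^p_m(t^m_p(\alpha))$ and $\beta\circ^m_p\alpha=1^p_m(s^m_p(\alpha))$. The inverse is unique, and $j^m_p(\alpha):=\beta$ makes every strict $(\infty,n)$-category an $(\infty,n)$-magma. Morphisms are strict $\infty$-functors. **$(\infty,n)$-categorical stretchings.** A tuple $(M,C,\pi,([-,-]_m)_{m\in\mathbb{N}})$ with $M$ an $(\infty,n)$-magma, $C$ a strict $(\infty,n)$-category, $\pi:M\to C$ a morphism of $(\infty,n)$-magmas, and maps $[-,-]_m:\widetilde M_m\to M_{m+1}$, where $\widetilde M_m=\{(c_1,c_0)\in M_m\times M_m: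 c_1\|c_0,\ \pi_m(c_1)=\pi_m(c_0)\}$, such that $t^{m+1}_m([c_1,c_0]_m)=c_1$, $s^{m+1}_m([c_1,c_0]_m)=c_0$, $\pi_{m+1}([c_1,c_0]_m)=1^m_{m+1}(\pi_m(c_1))=1^m_{m+1}(\pi_m(c_0))$, and $[c,c]_m=1^m_{m+1}(c)$. Here for $m\ge1$, $c_1\|c_0$ means that $c_1$ and $c_0$ have the same $s^m_{m-1}$ and the same $t^m_{m-1}$; any two $0$-cells are parallel. A morphism $(M,C,\pi,[-,-])\to(M',C',\pi',[-,-]')$ is a pair $(f,c)$ of a morphism of $(\infty,n)$-magmas $f:M\to M'$ and a strict $\infty$-functor $c:C\to C'$ with $\pi'f=c\pi$ and $f_{m+1}([c_1,c_0]_m)=[f_m(c_1),f_m(c_0)]'_m$. The category is $(\infty,n)\text{-}\mathbb{E}\mathrm{t}\mathbb{C}\mathrm{at}$. **The monad.** The forgetful functor $U_n:(\infty,n)\text{-}\mathbb{E}\mathrm{t}\mathbb{C}\mathrm{at}\to\infty\text{-}\mathbb{G}\mathrm{r}$, $(M,C,\pi,[-,-])\mapsto M$, has a left adjoint $F_n$; write $F_n(G)=(M^n(G),C^n(G),\pi^n_G,[-,-])$ for the free $(\infty,n)$-categorical stretching on $G$. The induced monad on $\infty\text{-}\mathbb{G}\mathrm{r}$ is $\mathbb{T}^{(\infty,n)}=(T^n,\mu^n,\lambda^n)$, so $T^n(G)$ is the underlying $\infty$-graph of $M^n(G)$. A weak $(\infty,n)$-category is a $\mathbb{T}^{(\infty,n)}$-algebra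 $(G,v)$. *)

(* Defs.v *)
From mathcomp Require Import all_boot boolp.

Set Implicit Arguments.
Unset Strict Implicit.
Unset Printing Implicit Defensive.

Record category := Category {
  obj :> Type;
  hom : obj -> obj -> Type;
  idm : forall a, hom a a;
  cmp : forall a b c, hom b c -> hom a b -> hom a c;
  cmp_idl : forall a b (f : hom a b), cmp (idm b) f = f;
  cmp_idr : forall a b (f : hom a b), cmp f (idm a) = f;
  cmp_assoc : forall a b c d (h : hom c d) (g : hom b c) (f : hom a b),
    cmp h (cmp g f) = cmp (cmp h g) f
}.
Arguments hom {c} a b : rename.
Arguments idm {c} a : rename.
Arguments cmp {c a b c} g f : rename.

Declare Scope cat_scope.
Local Open Scope cat_scope.
Notation "g \c f" := (cmp g f) (at level 40, left associativity) : cat_scope.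

Record functor (C D : category) := Functor {
  fobj :> C -> D;
  fmap : forall a b : C, hom a b -> hom (fobj a) (fobj b);
  fmap_id : forall a : C, fmap (idm a) = idm (fobj a);
  fmap_cmp : forall (a b c : C) (g : hom b c) (f : hom a b),
    fmap (g \c f) = fmap g \c fmap f
}.
Arguments fmap {C D} F {a b} f : rename.

(** [adjunction F U]: the functor [F] is left adjoint to [U]. *)
Record adjunction (C D : category) (F : functor C D) (U : functor D C) :=
  Adjunction {
  adj_unit : forall a : C, hom a (U (F a));
  adj_counit : forall x : D, hom (F (U x)) x;
  adj_unit_natural : forall (a b : C) (f : hom a b),
    adj_unit b \c f = fmap U (fmap F f) \c adj_unit a;
  adj_counit_natural : forall (x y : D) (g : hom x y),
    g \c adj_counit x = adj_counit y \c fmap F (fmap U g);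
  triangleF : forall a : C, adj_counit (F a) \c fmap F (adj_unit a) = idm (F a);
  triangleU : forall x : D, fmap U (adj_counit x) \c adj_unit (U x) = idm (U x)
}.
Arguments adj_unit {C D F U} adj a : rename.
Arguments adj_counit {C D F U} adj x : rename.

Record monad (C : category) := Monad {
  monad_functor :> functor C C;
  monad_mu : forall a : C,
    hom (monad_functor (monad_functor a)) (monad_functor a);
  monad_eta : forall a : C, hom a (monad_functor a);
  monad_mu_natural : forall (a b : C) (f : hom a b),
    monad_mu b \c fmap monad_functor (fmap monad_functor f)
    = fmap monad_functor f \c monad_mu a;
  monad_eta_natural : forall (a b : C) (f : hom a b),
    monad_eta b \c f = fmap monad_functor f \c monad_eta a;
  monad_mu_assoc : forall a : C,
    monad_mu a \c monad_mu (monad_functor a)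
    = monad_mu a \c fmap monad_functor (monad_mu a);
  monad_mu_etal : forall a : C,
    monad_mu a \c monad_eta (monad_functor a) = idm (monad_functor a);
  monad_mu_etar : forall a : C,
    monad_mu a \c fmap monad_functor (monad_eta a) = idm (monad_functor a)
}.

Definition is_algebra (C : category) (T : monad C) (a : C) (v : hom (T a) a) :=
  v \c monad_eta T a = idm a /\ v \c monad_mu T a = v \c fmap T v.

Definition functor_comp (C D E : category) (G : functor D E) (F : functor C D) :
  functor C E.
Proof.
exists (fun a => G (F a)) (fun a b f => fmap G (fmap F f)).
- by move=> a; rewrite !fmap_id.
- by move=> a b c g f; rewrite !fmap_cmp.
Defined.

(** The monad [(U F, U counit F, unit)] induced by an adjunction. *)
Definition adj_monad (C D : category) (F : functor C D) (U : functor D C)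
  (adj : adjunction F U) : monad C.
Proof.
exists (functor_comp U F) (fun a => fmap U (adj_counit adj (F a))) (adj_unit adj).
- by move=> a b f; rewrite /= -!fmap_cmp adj_counit_natural.
- by move=> a b f; rewrite adj_unit_natural.
- by move=> a; rewrite /= -!fmap_cmp adj_counit_natural.
- by move=> a; rewrite /= triangleU.
- by move=> a; rewrite /= -!fmap_cmp triangleF fmap_id.
Defined.

Record graph := Graph {
  cell :> nat -> Type;
  src : forall m, cell m.+1 -> cell m;
  tgt : forall m, cell m.+1 -> cell m;
  src_src : forall m (x : cell m.+2), src (src x) = src (tgt x);
  tgt_tgt : forall m (x : cell m.+2), tgt (tgt x) = tgt (src x)
}.
Arguments src {X m} x : rename.
Arguments tgt {X m} x : rename.

Lemma ltnS_cases p m : p < m.+1 -> {p = m} + {p < m}.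
Proof.
by rewrite ltnS leq_eqVlt; case: (eqVneq p m) => /= [-> _|_ ->]; [left|right].
Qed.

(** For [p < m], [down d : X m -> X p] and [up u : X p -> X m] iterate the
    one-step maps [d] and [u]. *)
Fixpoint down (X : nat -> Type) (d : forall m, X m.+1 -> X m) (m p : nat) :
    p < m -> X m -> X p :=
  match m with
  | 0 => fun h _ => False_rect _ (notF h)
  | m'.+1 => fun h x =>
      match ltnS_cases h with
      | left e => ecast k (X k) (esym e) (d m' x)
      | right h' => down d h' (d m' x)
      end
  end.

Fixpoint up (X : nat -> Type) (u : forall m, X m -> X m.+1) (m p : nat) :
    p < m -> X p -> X m :=
  match m with
  | 0 => fun h _ => False_rect _ (notF h)
  | m'.+1 => fun h x =>
      match ltnS_cases h with
      | left e => u m' (ecast k (X k) e x)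
      | right h' => u m' (up u h' x)
      end
  end.

Lemma down1 (X : nat -> Type) (d : forall m, X m.+1 -> X m) p (h : p < p.+1) x :
  down d h x = d p x.
Proof.
rewrite /=; case: ltnS_cases => [e|h']; last by exfalso; move: h'; rewrite ltnn.
by rewrite (eq_irrelevance e erefl).
Qed.

Lemma downS (X : nat -> Type) (d : forall m, X m.+1 -> X m) m p
  (h : p < m) (hS : p < m.+1) x : down d hS x = down d h (d m x).
Proof.
rewrite /=; case: ltnS_cases => [e|h'].
  by exfalso; move: h; rewrite e ltnn.
by rewrite (bool_irrelevance h' h).
Qed.

Lemma up1 (X : nat -> Type) (u : forall m, X m -> X m.+1) p (h : p < p.+1) x :
  up u h x = u p x.
Proof.
rewrite /=; case: ltnS_cases => [e|h']; last by exfalso; move: h'; rewrite ltnn.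
by rewrite (eq_irrelevance e erefl).
Qed.

Lemma upS (X : nat -> Type) (u : forall m, X m -> X m.+1) m p
  (h : p < m) (hS : p < m.+1) x : up u hS x = u m (up u h x).
Proof.
rewrite /=; case: ltnS_cases => [e|h'].
  by exfalso; move: h; rewrite e ltnn.
by rewrite (bool_irrelevance h' h).
Qed.

(** Iterated sources and targets: [srcn h x] is $s^m_p(x)$ for [h : p < m]. *)
Definition srcn (X : graph) m p (h : p < m) : X m -> X p := down (@src X) h.
Definition tgtn (X : graph) m p (h : p < m) : X m -> X p := down (@tgt X) h.

Record graph_mor (X Y : graph) := GraphMor {
  gmap :> forall m, X m -> Y m;
  gmap_src : forall m (x : X m.+1), gmap (src x) = src (gmap x);
  gmap_tgt : forall m (x : X m.+1), gmap (tgt x) = tgt (gmap x)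
}.
Arguments gmap {X Y} f [m] x : rename.

Lemma graph_mor_eq (X Y : graph) (f g : graph_mor X Y) :
  (forall m (x : X m), f m x = g m x) -> f = g.
Proof.
case: f g => f f1 f2 [g g1 g2] /= efg.
have e : f = g by apply: functional_extensionality_dep => m; apply/funext.
case: _ / e g1 g2 {efg} => g1 g2.
by rewrite (Prop_irrelevance f1 g1) (Prop_irrelevance f2 g2).
Qed.

Definition graph_id (X : graph) : graph_mor X X :=
  @GraphMor X X (fun m x => x) (fun _ _ => erefl) (fun _ _ => erefl).

Definition graph_cmp (X Y Z : graph) (g : graph_mor Y Z) (f : graph_mor X Y) :
  graph_mor X Z.
Proof.
exists (fun m x => g m (f m x)).
- by move=> m x; rewrite !gmap_src.
- by move=> m x; rewrite !gmap_tgt.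
Defined.

Definition graphCat : category.
Proof.
exists graph graph_mor graph_id graph_cmp; by move=> *; exact: graph_mor_eq.
Defined.

Lemma gmap_srcn (X Y : graph) (f : graph_mor X Y) m p (h : p < m) (x : X m) :
  f p (srcn h x) = srcn h (f m x).
Proof.
elim: m h x => [//|m IH] h x; case: (ltnS_cases h) => [e|h'].
  by move: e h => -> h; rewrite /srcn !down1 gmap_src.
by rewrite /srcn !(downS _ h') -/(srcn _ _) IH gmap_src.
Qed.

Lemma gmap_tgtn (X Y : graph) (f : graph_mor X Y) m p (h : p < m) (x : X m) :
  f p (tgtn h x) = tgtn h (f m x).
Proof.
elim: m h x => [//|m IH] h x; case: (ltnS_cases h) => [e|h'].
  by move: e h => -> h; rewrite /tgtn !down1 gmap_tgt.
by rewrite /tgtn !(downS _ h') -/(tgtn _ _) IH gmap_tgt.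
Qed.

Definition composable (X : graph) m p (h : p < m) (y x : X m) : Prop :=
  srcn h y = tgtn h x.

Lemma gmap_composable (X Y : graph) (f : graph_mor X Y) m p (h : p < m)
  (y x : X m) : composable h y x -> composable h (f m y) (f m x).
Proof. by rewrite /composable => e; rewrite -gmap_srcn e gmap_tgtn. Qed.

Record reflexive_on (X : graph) := ReflexiveOn {
  reflexor : forall m, X m -> X m.+1;
  src_reflexor : forall m (x : X m), src (reflexor x) = x;
  tgt_reflexor : forall m (x : X m), tgt (reflexor x) = x
}.
Arguments reflexor {X} R {m} x : rename.

(** [reflexorn R h x] is $1^p_m(x)$ for [h : p < m]. *)
Definition reflexorn (X : graph) (R : reflexive_on X) m p (h : p < m) :
  X p -> X m := up (@reflexor X R) h.

Record reversible_on (n : nat) (X : graph) := ReversibleOn {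
  reversor : forall m p, n <= p -> p < m -> X m -> X m;
  src_reversor1 : forall p (np : n <= p) (h : p < p.+1) (x : X p.+1),
    src (reversor np h x) = tgt x;
  tgt_reversor1 : forall p (np : n <= p) (h : p < p.+1) (x : X p.+1),
    tgt (reversor np h x) = src x;
  src_reversor : forall m p (np : n <= p) (h : p < m) (hS : p < m.+1) (x : X m.+1),
    src (reversor np hS x) = reversor np h (src x);
  tgt_reversor : forall m p (np : n <= p) (h : p < m) (hS : p < m.+1) (x : X m.+1),
    tgt (reversor np hS x) = reversor np h (tgt x)
}.
Arguments reversor {n X} R {m p} np h x : rename.

(** [mcomp e], for [e : composable h y x], is $y \circ^m_p x$. Here and in
    [is_strict], equations are stated for all proofs that the composites
    involved exist; except for associativity and interchange, where they express
    that the law applies, the conditions beyond the composability assumed in the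
    law always hold. *)
Record magma_on (X : graph) := MagmaOn {
  magma_refl :> reflexive_on X;
  mcomp : forall m p (h : p < m) (y x : X m), composable h y x -> X m;
  srcn_mcomp_lt : forall m q p (hpq : p < q) (hqm : q < m) (hpm : p < m)
    (y x : X m) (e : composable hpm y x)
    (e' : composable hpq (srcn hqm y) (srcn hqm x)),
    srcn hqm (mcomp e) = mcomp e';
  tgtn_mcomp_lt : forall m q p (hpq : p < q) (hqm : q < m) (hpm : p < m)
    (y x : X m) (e : composable hpm y x)
    (e' : composable hpq (tgtn hqm y) (tgtn hqm x)),
    tgtn hqm (mcomp e) = mcomp e';
  srcn_mcomp_ge : forall m p q (hqp : q <= p) (hpm : p < m) (hqm : q < m)
    (y x : X m) (e : composable hpm y x), srcn hqm (mcomp e) = srcn hqm x;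
  tgtn_mcomp_ge : forall m p q (hqp : q <= p) (hpm : p < m) (hqm : q < m)
    (y x : X m) (e : composable hpm y x), tgtn hqm (mcomp e) = tgtn hqm y
}.
Arguments mcomp {X} A {m p h y x} e : rename.

Definition is_magma_mor (X Y : graph) (A : magma_on X) (B : magma_on Y)
  (f : graph_mor X Y) : Prop :=
  (forall m (x : X m), f m.+1 (reflexor A x) = reflexor B (f m x)) /\
  (forall m p (h : p < m) (y x : X m) (e : composable h y x),
     f m (mcomp A e) = mcomp B (gmap_composable f e)).

Record nmagma_on (n : nat) (X : graph) := NMagmaOn {
  nmagma_magma :> magma_on X;
  nmagma_rev :> reversible_on n X
}.

Definition is_nmagma_mor n (X Y : graph) (A : nmagma_on n X)
  (B : nmagma_on n Y) (f : graph_mor X Y) : Prop :=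
  is_magma_mor A B f /\
  (forall m p (np : n <= p) (h : p < m) (x : X m),
     f m (reversor A np h x) = reversor B np h (f m x)).

Record is_strict (X : graph) (A : magma_on X) : Prop := IsStrict {
  mcomp_assoc : forall m p (h : p < m) (z y x : X m)
    (e1 : composable h z y) (e2 : composable h y x)
    (e3 : composable h (mcomp A e1) x) (e4 : composable h z (mcomp A e2)),
    mcomp A e3 = mcomp A e4;
  mcomp_unitr : forall m p (h : p < m) (x : X m)
    (e : composable h x (reflexorn A h (srcn h x))), mcomp A e = x;
  mcomp_unitl : forall m p (h : p < m) (x : X m)
    (e : composable h (reflexorn A h (tgtn h x)) x), mcomp A e = x;
  mcomp_interchange : forall m p q (hqp : q < p) (hpm : p < m) (hqm : q < m)
    (y' y x' x : X m)
    (e1 : composable hpm y' y) (e2 : composable hpm x' x)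
    (e3 : composable hqm y' x') (e4 : composable hqm y x)
    (e5 : composable hqm (mcomp A e1) (mcomp A e2))
    (e6 : composable hpm (mcomp A e3) (mcomp A e4)),
    mcomp A e5 = mcomp A e6;
  reflexorn_mcomp : forall m p q (hqp : q < p) (hpm : p < m) (hqm : q < m)
    (y x : X p) (e : composable hqp y x)
    (e' : composable hqm (reflexorn A hpm y) (reflexorn A hpm x)),
    reflexorn A hpm (mcomp A e) = mcomp A e'
}.

Definition is_inverse (X : graph) (A : magma_on X) m p (h : p < m)
  (a b : X m) : Prop :=
  exists (e1 : composable h a b) (e2 : composable h b a),
    mcomp A e1 = reflexorn A h (tgtn h a) /\ mcomp A e2 = reflexorn A h (srcn h a).

Record strict_ncat (n : nat) := StrictNCat {
  sc_graph :> graph;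
  sc_magma : magma_on sc_graph;
  sc_strict : is_strict sc_magma;
  sc_inverse : forall m p, n <= p -> forall (h : p < m) (a : sc_graph m),
    exists b, is_inverse sc_magma h a b
}.

Lemma srcn_par (X : graph) m p (h : p < m) (x : X m.+1) :
  srcn h (src x) = srcn h (tgt x).
Proof.
case: m h x => [//|m] h x; case: (ltnS_cases h) => [e|h'].
  by move: e h => -> h; rewrite /srcn !down1 src_src.
by rewrite /srcn !(downS _ h') src_src.
Qed.

Lemma tgtn_par (X : graph) m p (h : p < m) (x : X m.+1) :
  tgtn h (src x) = tgtn h (tgt x).
Proof.
case: m h x => [//|m] h x; case: (ltnS_cases h) => [e|h'].
  by move: e h => -> h; rewrite /tgtn !down1 tgt_tgt.
by rewrite /tgtn !(downS _ h') tgt_tgt.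
Qed.

Lemma composable_src (X : graph) m p (h : p < m) (hS : p < m.+1)
  (y x : X m.+1) : composable hS y x -> composable h (src y) (src x).
Proof.
rewrite /composable /srcn /tgtn !(downS _ h) => ->.
exact: esym (tgtn_par h x).
Qed.

Lemma composable_tgt (X : graph) m p (h : p < m) (hS : p < m.+1)
  (y x : X m.+1) : composable hS y x -> composable h (tgt y) (tgt x).
Proof.
rewrite /composable /srcn /tgtn !(downS _ h) => <-.
exact: esym (srcn_par h y).
Qed.

Lemma srcn_reflexorn (X : graph) (R : reflexive_on X) m p (h : p < m) (x : X p) :
  srcn h (reflexorn R h x) = x.
Proof.
elim: m h => [//|m IH] h; case: (ltnS_cases h) => [e|h'].
  by case: _ / e h => h; rewrite /srcn /reflexorn down1 up1 src_reflexor.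
by rewrite /srcn /reflexorn (downS _ h') (upS _ h') src_reflexor; exact: IH.
Qed.

Lemma tgtn_reflexorn (X : graph) (R : reflexive_on X) m p (h : p < m) (x : X p) :
  tgtn h (reflexorn R h x) = x.
Proof.
elim: m h => [//|m IH] h; case: (ltnS_cases h) => [e|h'].
  by case: _ / e h => h; rewrite /tgtn /reflexorn down1 up1 tgt_reflexor.
by rewrite /tgtn /reflexorn (downS _ h') (upS _ h') tgt_reflexor; exact: IH.
Qed.

Lemma mcomp_congr (X : graph) (A : magma_on X) m p (h : p < m) (y y' x x' : X m)
  (e : composable h y x) (e' : composable h y' x') :
  y = y' -> x = x' -> mcomp A e = mcomp A e'.
Proof. by move=> hy hx; subst; rewrite (Prop_irrelevance e e'). Qed.

Lemma inverse_unique (X : graph) (A : magma_on X) (S : is_strict A) m p (h : p < m) (a b b' : X m) :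
  is_inverse A h a b -> is_inverse A h a b' -> b = b'.
Proof.
move=> [ab [ba [_ eba]]] [ab' [b'a [eab' _]]].
have e1 : composable h b (reflexorn A h (srcn h b)).
  by rewrite /composable tgtn_reflexorn.
have e2 : composable h b (mcomp A ab').
  by rewrite /composable eab' tgtn_reflexorn ba.
have e3 : composable h (mcomp A ba) b'.
  by rewrite /composable eba srcn_reflexorn.
have e4 : composable h (reflexorn A h (tgtn h b')) b'.
  by rewrite /composable srcn_reflexorn.
rewrite -(mcomp_unitr S e1) -[RHS](mcomp_unitl S e4).
transitivity (mcomp A e2); first by apply: mcomp_congr; rewrite // eab' ba.
rewrite -(mcomp_assoc S e3).
by apply: mcomp_congr; rewrite // eba ab'.
Qed.

Lemma src_inverse (X : graph) (A : magma_on X) m p (h : p < m) (hS : p < m.+1) (a b : X m.+1) :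
  is_inverse A hS a b -> is_inverse A h (src a) (src b).
Proof.
move=> [ab [ba [eab eba]]].
exists (composable_src h ab), (composable_src h ba).
have E (y x : X m.+1) (e : composable hS y x) :
    mcomp A (composable_src h e) = src (mcomp A e).
  have e' : composable h (srcn (ltnSn m) y) (srcn (ltnSn m) x).
    by rewrite /srcn !down1; exact: composable_src e.
  transitivity (srcn (ltnSn m) (mcomp A e)); last by rewrite /srcn down1.
  by rewrite (srcn_mcomp_lt A e e'); apply: mcomp_congr; rewrite /srcn down1.
rewrite !E eab eba /reflexorn !(upS _ h) !src_reflexor; split; congr (up _ _ _).
  by rewrite tgtn_par /tgtn (downS _ h).
by rewrite /srcn (downS _ h).
Qed.

Lemma tgt_inverse (X : graph) (A : magma_on X) m p (h : p < m) (hS : p < m.+1) (a b : X m.+1) :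
  is_inverse A hS a b -> is_inverse A h (tgt a) (tgt b).
Proof.
move=> [ab [ba [eab eba]]].
exists (composable_tgt h ab), (composable_tgt h ba).
have E (y x : X m.+1) (e : composable hS y x) :
    mcomp A (composable_tgt h e) = tgt (mcomp A e).
  have e' : composable h (tgtn (ltnSn m) y) (tgtn (ltnSn m) x).
    by rewrite /tgtn !down1; exact: composable_tgt e.
  transitivity (tgtn (ltnSn m) (mcomp A e)); last by rewrite /tgtn down1.
  by rewrite (tgtn_mcomp_lt A e e'); apply: mcomp_congr; rewrite /tgtn down1.
rewrite !E eab eba /reflexorn !(upS _ h) !tgt_reflexor; split; congr (up _ _ _).
  by rewrite /tgtn (downS _ h).
by rewrite -srcn_par /srcn (downS _ h).
Qed.

(** By [inverse_unique], the inverse chosen here is the only one. *)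
Definition sc_inv n (C : strict_ncat n) m p (np : n <= p) (h : p < m)
  (a : C m) : C m := projT1 (cid (sc_inverse np h a)).

Lemma sc_invP n (C : strict_ncat n) m p (np : n <= p) (h : p < m) (a : C m) :
  is_inverse (sc_magma C) h a (sc_inv np h a).
Proof. exact: projT2 (cid (sc_inverse np h a)). Qed.

Definition sc_rev n (C : strict_ncat n) : reversible_on n C.
Proof.
exists (@sc_inv n C).
- move=> p np h x; have [_ [+ _]] := sc_invP np h x.
  by rewrite /composable /srcn /tgtn !down1.
- move=> p np h x; have [+ _] := sc_invP np h x.
  by rewrite /composable /srcn /tgtn !down1.
- move=> m p np h hS x.
  apply: (inverse_unique (sc_strict C)) (sc_invP np h (src x)).
  exact: src_inverse (sc_invP np hS x).
- move=> m p np h hS x.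
  apply: (inverse_unique (sc_strict C)) (sc_invP np h (tgt x)).
  exact: tgt_inverse (sc_invP np hS x).
Defined.

Definition sc_nmagma n (C : strict_ncat n) : nmagma_on n C :=
  NMagmaOn (sc_magma C) (sc_rev C).

Definition parallel (X : graph) (m : nat) : X m -> X m -> Prop :=
  match m with
  | 0 => fun _ _ => True
  | m'.+1 => fun c1 c0 => src c1 = src c0 /\ tgt c1 = tgt c0
  end.

Record stretching (n : nat) := Stretching {
  st_graph : graph;
  st_magma : nmagma_on n st_graph;
  st_cat : strict_ncat n;
  st_pi : graph_mor st_graph st_cat;
  st_pi_mor : is_nmagma_mor st_magma (sc_nmagma st_cat) st_pi;
  st_br : forall m (c1 c0 : st_graph m), parallel c1 c0 ->
    st_pi m c1 = st_pi m c0 -> st_graph m.+1;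
  st_br_tgt : forall m (c1 c0 : st_graph m) (h : parallel c1 c0)
    (e : st_pi m c1 = st_pi m c0), tgt (st_br h e) = c1;
  st_br_src : forall m (c1 c0 : st_graph m) (h : parallel c1 c0)
    (e : st_pi m c1 = st_pi m c0), src (st_br h e) = c0;
  st_br_pi : forall m (c1 c0 : st_graph m) (h : parallel c1 c0)
    (e : st_pi m c1 = st_pi m c0),
    st_pi m.+1 (st_br h e) = reflexor (sc_magma st_cat) (st_pi m c1) /\
    st_pi m.+1 (st_br h e) = reflexor (sc_magma st_cat) (st_pi m c0);
  st_br_diag : forall m (c : st_graph m) (h : parallel c c)
    (e : st_pi m c = st_pi m c), st_br h e = reflexor st_magma c
}.
Arguments st_pi {n} E : rename.
Arguments st_br {n} E {m c1 c0} h e : rename.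

Lemma gmap_parallel (X Y : graph) (f : graph_mor X Y) m (c1 c0 : X m) :
  parallel c1 c0 -> parallel (f m c1) (f m c0).
Proof.
by case: m c1 c0 => [//|m] c1 c0 [es et]; split; rewrite -?gmap_src -?gmap_tgt ?es ?et.
Qed.

(** In [sm_br], the conditions [h'] and [e'] follow from [h] and [e]. *)
Record stretching_mor n (E E' : stretching n) := StretchingMor {
  sm_fun : graph_mor (st_graph E) (st_graph E');
  sm_cat : graph_mor (st_cat E) (st_cat E');
  sm_fun_mor : is_nmagma_mor (st_magma E) (st_magma E') sm_fun;
  sm_cat_mor : is_magma_mor (sc_magma (st_cat E)) (sc_magma (st_cat E')) sm_cat;
  sm_square : graph_cmp (st_pi E') sm_fun = graph_cmp sm_cat (st_pi E);
  sm_br : forall m (c1 c0 : st_graph E m) (h : parallel c1 c0)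
    (e : st_pi E m c1 = st_pi E m c0) (h' : parallel (sm_fun m c1) (sm_fun m c0))
    (e' : st_pi E' m (sm_fun m c1) = st_pi E' m (sm_fun m c0)),
    sm_fun m.+1 (st_br E h e) = st_br E' h' e'
}.

Lemma stretching_mor_eq n (E E' : stretching n) (f g : stretching_mor E E') :
  sm_fun f = sm_fun g -> sm_cat f = sm_cat g -> f = g.
Proof.
case: f g => f c f1 f2 f3 f4 [g d g1 g2 g3 g4] /= ef ec; subst.
by congr StretchingMor; exact: Prop_irrelevance.
Qed.

Lemma is_magma_mor_id (X : graph) (A : magma_on X) :
  is_magma_mor A A (graph_id X).
Proof. by split=> // *; exact: mcomp_congr. Qed.

Lemma is_magma_mor_cmp (X Y Z : graph) (A : magma_on X) (B : magma_on Y)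
  (C : magma_on Z) (g : graph_mor Y Z) (f : graph_mor X Y) :
  is_magma_mor B C g -> is_magma_mor A B f -> is_magma_mor A C (graph_cmp g f).
Proof.
move=> [g1 g2] [f1 f2]; split=> [m x|m p h y x e] /=; first by rewrite f1 g1.
by rewrite f2 g2; exact: mcomp_congr.
Qed.

Definition stretching_id n (E : stretching n) : stretching_mor E E.
Proof.
exists (graph_id _) (graph_id _).
- by split=> //; exact: is_magma_mor_id.
- exact: is_magma_mor_id.
- exact: graph_mor_eq.
- move=> m c1 c0 h e h' e' /=.
  by rewrite (Prop_irrelevance h h') (Prop_irrelevance e e').
Defined.

Lemma sm_squareE n (E E' : stretching n) (f : stretching_mor E E') m
  (x : st_graph E m) : st_pi E' m (sm_fun f m x) = sm_cat f m (st_pi E m x).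
Proof. by rewrite -[LHS]/(graph_cmp (st_pi E') (sm_fun f) m x) sm_square. Qed.

Definition stretching_cmp n (E1 E2 E3 : stretching n)
  (g : stretching_mor E2 E3) (f : stretching_mor E1 E2) : stretching_mor E1 E3.
Proof.
exists (graph_cmp (sm_fun g) (sm_fun f)) (graph_cmp (sm_cat g) (sm_cat f)).
- have [f1 f2] := sm_fun_mor f; have [g1 g2] := sm_fun_mor g.
  split; first exact: is_magma_mor_cmp g1 f1.
  by move=> m p np h x /=; rewrite f2 g2.
- exact: is_magma_mor_cmp (sm_cat_mor g) (sm_cat_mor f).
- by apply: graph_mor_eq => m x /=; rewrite !sm_squareE.
- move=> m c1 c0 h e h' e' /=.
  have e1 : st_pi E2 m (sm_fun f m c1) = st_pi E2 m (sm_fun f m c0).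
    by rewrite !sm_squareE e.
  by rewrite (sm_br h e (gmap_parallel (sm_fun f) h) e1); exact: sm_br.
Defined.

Definition stretchingCat (n : nat) : category.
Proof.
exists (stretching n) (@stretching_mor n) (@stretching_id n) (@stretching_cmp n);
  move=> *; apply: stretching_mor_eq; exact: graph_mor_eq.
Defined.

Definition forget (n : nat) : functor (stretchingCat n) graphCat.
Proof.
exists (fun E : stretchingCat n => st_graph E : graphCat)
  (fun (E E' : stretchingCat n) f => sm_fun f); by [].
Defined.

(** The cells of the free stretching on [G] are the terms that have a value in
    every stretching under [G], identified when these values all agree. The
    boolean index of a term is [false] for cells of the magma and [true] for
    cells of the strict category. *)
Module FreeStretching.

Lemma universal_adjunction (C D : category) (U : functor D C) (F0 : C -> D)
  (eta : forall a, hom a (U (F0 a)))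
  (ext : forall a x, hom a (U x) -> hom (F0 a) x) :
  (forall a x (f : hom a (U x)), fmap U (ext a x f) \c eta a = f) ->
  (forall a x (g : hom (F0 a) x), ext a x (fmap U g \c eta a) = g) ->
  exists F : functor C D, inhabited (adjunction F U).
Proof.
move=> ext1 ext2.
have uniq a x (g g' : hom (F0 a) x) :
    fmap U g \c eta a = fmap U g' \c eta a -> g = g'.
  by move=> e; rewrite -[g]ext2 e ext2.
pose fm (a b : C) (f : hom a b) := ext a (F0 b) (eta b \c f).
have fm1 a : fm a a (idm a) = idm (F0 a).
  by apply: uniq; rewrite ext1 fmap_id cmp_idl cmp_idr.
have fm2 a b c g f : fm a c (g \c f) = fm b c g \c fm a b f.
  apply: uniq; rewrite ext1 fmap_cmp -cmp_assoc ext1 !cmp_assoc.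
  by rewrite ext1.
exists (Functor fm1 fm2); constructor.
apply: (@Adjunction C D (Functor fm1 fm2) U eta
  (fun x => ext (U x) x (idm (U x)))).
- by move=> a b f; rewrite /= /fm ext1.
- move=> x y g; apply: uniq; rewrite /= /fm !fmap_cmp -!cmp_assoc !ext1.
  by rewrite cmp_assoc ext1 cmp_idl cmp_idr.
- move=> a; apply: uniq; rewrite /= /fm fmap_cmp -cmp_assoc ext1.
  by rewrite cmp_assoc ext1 fmap_id cmp_idl.
- by move=> x; rewrite ext1.
Qed.

Definition st_sort n (E : stretching n) (s : bool) : graph :=
  if s then sc_graph (st_cat E) else st_graph E.

Definition st_sort_magma n (E : stretching n) (s : bool) :
    nmagma_on n (st_sort E s) :=
  if s return nmagma_on n (st_sort E s) then sc_nmagma (st_cat E)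
  else st_magma E.

Lemma gmap_reflexorn (X Y : graph) (A : magma_on X) (B : magma_on Y)
  (f : graph_mor X Y) : is_magma_mor A B f ->
  forall m p (h : p < m) (x : X p),
    f m (reflexorn A h x) = reflexorn B h (f p x).
Proof.
move=> [f1 _]; elim=> [//|m IH] p h x; case: (ltnS_cases h) => [e|h'].
  by case: _ / e h => h; rewrite /reflexorn !up1 f1.
by rewrite /reflexorn !(upS _ h') f1; congr reflexor; exact: IH.
Qed.

Lemma is_magma_mor_inverse (X Y : graph) (A : magma_on X) (B : magma_on Y)
  (f : graph_mor X Y) m p (h : p < m) (a b : X m) :
  is_magma_mor A B f -> is_inverse A h a b -> is_inverse B h (f m a) (f m b).
Proof.
move=> fM [e1 [e2 [H1 H2]]]; have [_ f2] := fM.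
exists (gmap_composable f e1), (gmap_composable f e2).
by rewrite -!f2 H1 H2 !(gmap_reflexorn fM) gmap_srcn gmap_tgtn.
Qed.

Lemma st_br_congr n (E : stretching n) m (c1 c0 c1' c0' : st_graph E m)
  (h : parallel c1 c0) (e : st_pi E m c1 = st_pi E m c0)
  (h' : parallel c1' c0') (e' : st_pi E m c1' = st_pi E m c0') :
  c1 = c1' -> c0 = c0' -> st_br E h e = st_br E h' e'.
Proof.
move=> h1 h0; subst.
by rewrite (Prop_irrelevance h h') (Prop_irrelevance e e').
Qed.

Section Free.
Variables (n : nat) (G : graph).

Inductive term : bool -> nat -> Type :=
| tgen m : G m -> term false m
| tsrc s m : term s m.+1 -> term s m
| ttgt s m : term s m.+1 -> term s m
| trefl s m : term s m -> term s m.+1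
| trev s m p : n <= p -> p < m -> term s m -> term s m
| tcomp s m p : p < m -> term s m -> term s m -> term s m
| tpi m : term false m -> term true m
| tbr m : term false m -> term false m -> term false m.+1.

Section Eval.
Variables (E : stretching n) (f : graph_mor G (st_graph E)).

Fixpoint eval s m (t : term s m) : option (st_sort E s m) :=
  match t in term s m return option (st_sort E s m) with
  | tgen m x => Some (f m x)
  | tsrc s m t => omap (@src (st_sort E s) m) (eval t)
  | ttgt s m t => omap (@tgt (st_sort E s) m) (eval t)
  | trefl s m t => omap (@reflexor _ (st_sort_magma E s) m) (eval t)
  | trev s m p np h t => omap (reversor (st_sort_magma E s) np h) (eval t)
  | tcomp s m p h ty tx =>
      if eval ty is Some y then
        if eval tx is Some x then
          if pselect (composable h y x) is left e
          then Some (mcomp (st_sort_magma E s) e) else None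
        else None
      else None
  | tpi m t => omap (st_pi E m) (eval t)
  | tbr m t1 t0 =>
      if eval t1 is Some c1 then
        if eval t0 is Some c0 then
          if pselect (parallel c1 c0) is left h then
            if pselect (st_pi E m c1 = st_pi E m c0) is left e
            then Some (st_br E h e) else None
          else None
        else None
      else None
  end.

Lemma eval_comp s m p (h : p < m) (ty tx : term s m) y x
  (e : composable h y x) : eval ty = Some y -> eval tx = Some x ->
  eval (tcomp h ty tx) = Some (mcomp (st_sort_magma E s) e).
Proof.
move=> /= -> ->; case: pselect => [e'|//].
by rewrite (Prop_irrelevance e e').
Qed.

Lemma eval_br m (t1 t0 : term false m) (c1 c0 : st_graph E m)
  (h : parallel c1 c0) (e : st_pi E m c1 = st_pi E m c0) :
  eval t1 = Some c1 -> eval t0 = Some c0 ->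
  eval (tbr t1 t0) = Some (st_br E h e).
Proof.
move=> /= -> ->; case: pselect => [h'|//]; case: pselect => [e'|//].
by rewrite (Prop_irrelevance e e') (Prop_irrelevance h h').
Qed.

End Eval.

Definition defined s m (t : term s m) : Prop :=
  forall (E : stretching n) (f : graph_mor G (st_graph E)),
    exists c, eval f t = Some c.

Definition eqv s m (t t' : term s m) : Prop :=
  forall (E : stretching n) (f : graph_mor G (st_graph E)),
    eval f t = eval f t'.

Definition fcell s m : Type :=
  {P : term s m -> Prop | exists t, defined t /\ P = eqv t}.

Definition mk s m (t : term s m) (d : defined t) : fcell s m :=
  exist _ (eqv t) (ex_intro _ t (conj d erefl)).

Definition rep s m (c : fcell s m) : term s m := projT1 (cid (proj2_sig c)).

Lemma rep_defined s m (c : fcell s m) : defined (rep c).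
Proof. by rewrite /rep; case: cid => t []. Qed.

Lemma rep_eqv s m (c : fcell s m) : proj1_sig c = eqv (rep c).
Proof. by rewrite /rep; case: cid => t []. Qed.

Definition val (E : stretching n) (f : graph_mor G (st_graph E)) s m
  (c : fcell s m) : st_sort E s m := projT1 (cid (rep_defined c f)).

Lemma eval_rep E (f : graph_mor G (st_graph E)) s m (c : fcell s m) :
  eval f (rep c) = Some (val f c).
Proof. exact: projT2 (cid (rep_defined c f)). Qed.

Lemma val_mk E (f : graph_mor G (st_graph E)) s m (t : term s m)
  (d : defined t) x : eval f t = Some x -> val f (mk d) = x.
Proof.
move=> ex; apply: Some_inj; rewrite -eval_rep -ex.
have : eqv (rep (mk d)) t by rewrite -rep_eqv.
by apply.
Qed.

Lemma val_inj s m (c c' : fcell s m) :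
  (forall E (f : graph_mor G (st_graph E)), val f c = val f c') -> c = c'.
Proof.
move=> H; have : proj1_sig c = proj1_sig c'.
  have e : eqv (rep c) (rep c') by move=> E f; rewrite !eval_rep H.
  rewrite !rep_eqv; apply/funext => t.
  by apply/propext; split=> et E f; rewrite -et e.
case: c c' {H} => [P hP] [Q hQ] /= e; case: _ / e hQ => hQ.
by rewrite (Prop_irrelevance hP hQ).
Qed.

Lemma omap_defined s m s' m' (o : term s m -> term s' m')
  (oE : forall E, st_sort E s m -> st_sort E s' m') :
  (forall E (f : graph_mor G (st_graph E)) t,
     eval f (o t) = omap (oE E) (eval f t)) ->
  forall t, defined t -> defined (o t).
Proof.
by move=> H t d E f; have [c e] := d E f; exists (oE E c); rewrite H e.
Qed.


Definition fsrc s m (c : fcell s m.+1) : fcell s m :=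
  mk (omap_defined (o := @tsrc s m) (fun _ _ _ => erefl) (rep_defined c)).
Definition ftgt s m (c : fcell s m.+1) : fcell s m :=
  mk (omap_defined (o := @ttgt s m) (fun _ _ _ => erefl) (rep_defined c)).
Definition frefl s m (c : fcell s m) : fcell s m.+1 :=
  mk (omap_defined (o := @trefl s m) (fun _ _ _ => erefl) (rep_defined c)).
Definition frev s m p (np : n <= p) (h : p < m) (c : fcell s m) : fcell s m :=
  mk (omap_defined (o := @trev s m p np h) (fun _ _ _ => erefl)
    (rep_defined c)).
Definition fpi m (c : fcell false m) : fcell true m :=
  mk (omap_defined (o := @tpi m) (fun _ _ _ => erefl) (rep_defined c)).

Section Val.
Variables (E : stretching n) (f : graph_mor G (st_graph E)).

Lemma val_src s m (c : fcell s m.+1) : val f (fsrc c) = src (val f c).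
Proof. by apply: val_mk; rewrite /= eval_rep. Qed.
Lemma val_tgt s m (c : fcell s m.+1) : val f (ftgt c) = tgt (val f c).
Proof. by apply: val_mk; rewrite /= eval_rep. Qed.
Lemma val_refl s m (c : fcell s m) :
  val f (frefl c) = reflexor (st_sort_magma E s) (val f c).
Proof. by apply: val_mk; rewrite /= eval_rep. Qed.
Lemma val_rev s m p (np : n <= p) (h : p < m) (c : fcell s m) :
  val f (frev np h c) = reversor (st_sort_magma E s) np h (val f c).
Proof. by apply: val_mk; rewrite /= eval_rep. Qed.
Lemma val_pi m (c : fcell false m) : val f (fpi c) = st_pi E m (val f c).
Proof. by apply: val_mk; rewrite /= eval_rep. Qed.

End Val.

Definition fgraph (s : bool) : graph.
Proof.
by exists (fcell s) (@fsrc s) (@ftgt s) => m x; apply: val_inj => E f;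
  rewrite ?(val_src, val_tgt) ?src_src ?tgt_tgt.
Defined.

Definition valm E (f : graph_mor G (st_graph E)) s :
    graph_mor (fgraph s) (st_sort E s) :=
  @GraphMor (fgraph s) (st_sort E s) (@val E f s) (@val_src E f s)
    (@val_tgt E f s).

Lemma fcomp_defined s m p (h : p < m) (y x : fgraph s m)
  (e : composable h y x) : defined (tcomp h (rep y) (rep x)).
Proof.
move=> E f; exists (mcomp (st_sort_magma E s) (gmap_composable (valm f s) e)).
by apply: eval_comp; exact: eval_rep.
Qed.

Definition fcomp s m p (h : p < m) (y x : fgraph s m) (e : composable h y x) :
  fgraph s m := mk (fcomp_defined e).

Lemma val_comp E (f : graph_mor G (st_graph E)) s m p (h : p < m)
  (y x : fgraph s m) (e : composable h y x) :
  valm f s m (fcomp e)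
  = mcomp (st_sort_magma E s) (gmap_composable (valm f s) e).
Proof. by apply: val_mk; apply: eval_comp; exact: eval_rep. Qed.

Definition freflexive s : reflexive_on (fgraph s).
Proof.
exists (@frefl s) => m x; apply: val_inj => E f.
- by rewrite val_src val_refl src_reflexor.
- by rewrite val_tgt val_refl tgt_reflexor.
Defined.

Lemma fgraph_inj s m (c c' : fgraph s m) :
  (forall E (f : graph_mor G (st_graph E)), valm f s m c = valm f s m c') ->
  c = c'.
Proof. exact: val_inj. Qed.

Definition fmagma s : magma_on (fgraph s).
Proof.
apply: (@MagmaOn _ (freflexive s) (@fcomp s)).
- move=> m q p hpq hqm hpm y x e e'; apply: fgraph_inj => E f.
  rewrite gmap_srcn !val_comp.
  have e0 : composable hpq (srcn hqm (valm f s m y)) (srcn hqm (valm f s m x)).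
    by rewrite -!gmap_srcn; exact: gmap_composable.
  by rewrite (srcn_mcomp_lt _ _ e0); apply: mcomp_congr; rewrite gmap_srcn.
- move=> m q p hpq hqm hpm y x e e'; apply: fgraph_inj => E f.
  rewrite gmap_tgtn !val_comp.
  have e0 : composable hpq (tgtn hqm (valm f s m y)) (tgtn hqm (valm f s m x)).
    by rewrite -!gmap_tgtn; exact: gmap_composable.
  by rewrite (tgtn_mcomp_lt _ _ e0); apply: mcomp_congr; rewrite gmap_tgtn.
- move=> m p q hqp hpm hqm y x e; apply: fgraph_inj => E f.
  by rewrite !gmap_srcn val_comp srcn_mcomp_ge.
- move=> m p q hqp hpm hqm y x e; apply: fgraph_inj => E f.
  by rewrite !gmap_tgtn val_comp tgtn_mcomp_ge.
Defined.

Definition freversible s : reversible_on n (fgraph s).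
Proof.
exists (@frev s).
- move=> p np h x; apply: val_inj => E f.
  by rewrite val_src val_rev src_reversor1 val_tgt.
- move=> p np h x; apply: val_inj => E f.
  by rewrite val_tgt val_rev tgt_reversor1 val_src.
- move=> m p np h hS x; apply: val_inj => E f.
  by rewrite val_src !val_rev (src_reversor _ _ h) val_src.
- move=> m p np h hS x; apply: val_inj => E f.
  by rewrite val_tgt !val_rev (tgt_reversor _ _ h) val_tgt.
Defined.

Definition fnmagma s : nmagma_on n (fgraph s) :=
  NMagmaOn (fmagma s) (freversible s).

Lemma valm_magma_mor E (f : graph_mor G (st_graph E)) s :
  is_magma_mor (fmagma s) (st_sort_magma E s) (valm f s).
Proof. by split=> *; [exact: val_refl|exact: val_comp]. Qed.

Definition cvalm E (f : graph_mor G (st_graph E)) :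
  graph_mor (fgraph true) (st_cat E) := valm f true.

Lemma cvalm_mor E (f : graph_mor G (st_graph E)) :
  is_magma_mor (fmagma true) (sc_magma (st_cat E)) (cvalm f).
Proof. exact: (valm_magma_mor f true). Qed.

Lemma val_ccomp E (f : graph_mor G (st_graph E)) m p (h : p < m)
  (y x : fgraph true m) (e : composable h y x) :
  cvalm f m (mcomp (fmagma true) e)
  = mcomp (sc_magma (st_cat E)) (gmap_composable (cvalm f) e).
Proof. exact: (val_comp f e). Qed.

Lemma fcell_inj m (c c' : fgraph true m) :
  (forall E (f : graph_mor G (st_graph E)), cvalm f m c = cvalm f m c') ->
  c = c'.
Proof. by move=> H; apply: val_inj => E f; exact: (H E f). Qed.

Lemma fcat_strict : is_strict (fmagma true).
Proof.
split.
- move=> m p h z y x e1 e2 e3 e4; apply: fcell_inj => E f.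
  set v := cvalm f.
  have e3' := gmap_composable v e3; have e4' := gmap_composable v e4.
  rewrite !val_ccomp in e3' e4'; rewrite [LHS]val_ccomp [RHS]val_ccomp.
  etransitivity; last (etransitivity; first exact:
    (mcomp_assoc (sc_strict (st_cat E)) e3' e4')).
    by apply: mcomp_congr; rewrite ?val_ccomp.
  by apply: mcomp_congr; rewrite ?val_ccomp.
- move=> m p h x e; apply: fcell_inj => E f; rewrite val_ccomp.
  have rE := gmap_reflexorn (cvalm_mor f).
  have e' := gmap_composable (cvalm f) e.
  rewrite rE gmap_srcn in e'.
  rewrite -[RHS](mcomp_unitr (sc_strict (st_cat E)) e').
  by apply: mcomp_congr; rewrite // rE gmap_srcn.
- move=> m p h x e; apply: fcell_inj => E f; rewrite val_ccomp.
  have rE := gmap_reflexorn (cvalm_mor f).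
  have e' := gmap_composable (cvalm f) e.
  rewrite rE gmap_tgtn in e'.
  rewrite -[RHS](mcomp_unitl (sc_strict (st_cat E)) e').
  by apply: mcomp_congr; rewrite // rE gmap_tgtn.
- move=> m p q hqp hpm hqm y' y x' x e1 e2 e3 e4 e5 e6.
  apply: fcell_inj => E f; set v := cvalm f.
  have e5' := gmap_composable v e5; have e6' := gmap_composable v e6.
  rewrite !val_ccomp in e5' e6'; rewrite [LHS]val_ccomp [RHS]val_ccomp.
  etransitivity; last (etransitivity; first exact:
    (mcomp_interchange (sc_strict (st_cat E)) hqp e5' e6')).
    by apply: mcomp_congr; rewrite ?val_ccomp.
  by apply: mcomp_congr; rewrite ?val_ccomp.
- move=> m p q hqp hpm hqm y x e e'; apply: fcell_inj => E f.
  have rE := gmap_reflexorn (cvalm_mor f).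
  have e1 := gmap_composable (cvalm f) e'.
  rewrite !rE in e1; rewrite rE [RHS]val_ccomp val_ccomp.
  rewrite (reflexorn_mcomp (sc_strict (st_cat E)) _ e1).
  by apply: mcomp_congr; rewrite rE.
Qed.

Definition finv m p (np : n <= p) (h : p < m) (a : fgraph true m) :
  fgraph true m := frev np h a.

Lemma val_inv E (f : graph_mor G (st_graph E)) m p (np : n <= p) (h : p < m)
  (a : fgraph true m) : cvalm f m (finv np h a) = sc_inv np h (cvalm f m a).
Proof. exact: (val_rev f np h a). Qed.

Lemma finv_inverse m p (np : n <= p) (h : p < m) (a : fgraph true m) :
  is_inverse (fmagma true) h a (finv np h a).
Proof.
have e1 : composable h a (finv np h a).
  apply: fcell_inj => E f; rewrite gmap_srcn gmap_tgtn val_inv.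
  by have [+ _] := sc_invP np h (cvalm f m a).
have e2 : composable h (finv np h a) a.
  apply: fcell_inj => E f; rewrite gmap_srcn gmap_tgtn val_inv.
  by have [_ [+ _]] := sc_invP np h (cvalm f m a).
exists e1, e2; split; apply: fcell_inj => E f; rewrite val_ccomp;
    rewrite (gmap_reflexorn (cvalm_mor f)).
- have [i1 [i2 [H _]]] := sc_invP np h (cvalm f m a).
  by rewrite gmap_tgtn -H; apply: mcomp_congr; rewrite // val_inv.
- have [i1 [i2 [_ H]]] := sc_invP np h (cvalm f m a).
  by rewrite gmap_srcn -H; apply: mcomp_congr; rewrite // val_inv.
Qed.

Definition fcat : strict_ncat n :=
  @StrictNCat n (fgraph true) (fmagma true) fcat_strict
    (fun m p np h a => ex_intro _ _ (finv_inverse np h a)).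

Lemma fcat_rev m p (np : n <= p) (h : p < m) (a : fcat m) :
  reversor (sc_nmagma fcat) np h a = finv np h a.
Proof.
apply: (inverse_unique fcat_strict) (finv_inverse np h a).
exact: (sc_invP (C := fcat) np h a).
Qed.

Definition fproj : graph_mor (fgraph false) (fgraph true).
Proof.
exists fpi => m x; apply: val_inj => E f.
- by rewrite val_pi !val_src val_pi gmap_src.
- by rewrite val_pi !val_tgt val_pi gmap_tgt.
Defined.

Lemma fproj_mor : is_nmagma_mor (fnmagma false) (sc_nmagma fcat) fproj.
Proof.
split; first split.
- move=> m x; apply: val_inj => E f; have [[H _] _] := st_pi_mor E.
  by rewrite val_refl !val_pi val_refl H.
- move=> m p h y x e; apply: fgraph_inj => E f; have [[_ H] _] := st_pi_mor E.
  rewrite [LHS]val_pi [val _ _]val_comp H val_comp; apply: mcomp_congr;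
    by rewrite [RHS]val_pi.
- move=> m p np h x; rewrite fcat_rev; apply: val_inj => E f.
  have [_ H] := st_pi_mor E.
  by rewrite val_rev !val_pi val_rev H.
Qed.

Lemma fbr_defined m (c1 c0 : fgraph false m) (h : parallel c1 c0)
  (e : fproj m c1 = fproj m c0) : defined (tbr (rep c1) (rep c0)).
Proof.
move=> E f.
have e' : st_pi E m (valm f false m c1) = st_pi E m (valm f false m c0).
  by move: (congr1 (@val E f true m) (e : fpi c1 = fpi c0)); rewrite !val_pi.
exists (st_br E (gmap_parallel (valm f false) h) e').
by apply: eval_br; exact: eval_rep.
Qed.

Definition fbr m (c1 c0 : fgraph false m) (h : parallel c1 c0)
  (e : fproj m c1 = fproj m c0) : fgraph false m.+1 := mk (fbr_defined h e).

Lemma val_br E (f : graph_mor G (st_graph E)) m (c1 c0 : fgraph false m)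
  (h : parallel c1 c0) (e : fproj m c1 = fproj m c0)
  (h' : parallel (valm f false m c1) (valm f false m c0))
  (e' : st_pi E m (valm f false m c1) = st_pi E m (valm f false m c0)) :
  val f (fbr h e) = st_br E h' e'.
Proof. by apply: val_mk; apply: eval_br; exact: eval_rep. Qed.

Lemma val_br_ex E (f : graph_mor G (st_graph E)) m (c1 c0 : fgraph false m)
  (h : parallel c1 c0) (e : fproj m c1 = fproj m c0) :
  exists h' e', val f (fbr h e)
    = @st_br n E m (valm f false m c1) (valm f false m c0) h' e'.
Proof.
have e' : st_pi E m (valm f false m c1) = st_pi E m (valm f false m c0).
  by move: (congr1 (@val E f true m) (e : fpi c1 = fpi c0)); rewrite !val_pi.
by exists (gmap_parallel (valm f false) h), e'; exact: val_br.
Qed.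

Definition free_stretching : stretching n.
Proof.
exists (fgraph false) (fnmagma false) fcat fproj fbr.
- exact: fproj_mor.
- move=> m c1 c0 h e; apply: val_inj => E f.
  by have [h' [e' H]] := val_br_ex f h e; rewrite val_tgt H st_br_tgt.
- move=> m c1 c0 h e; apply: val_inj => E f.
  by have [h' [e' H]] := val_br_ex f h e; rewrite val_src H st_br_src.
- move=> m c1 c0 h e; split; apply: val_inj => E f;
    have [h' [e' H]] := val_br_ex f h e;
    have [H1 H0] := st_br_pi h' e';
    by rewrite val_pi val_refl val_pi H ?H1 ?H0 // -H1 H0.
- move=> m c h e; apply: val_inj => E f.
  by have [h' [e' H]] := val_br_ex f h e; rewrite H st_br_diag val_refl.
Defined.

Lemma gen_defined m (x : G m) : defined (tgen x).
Proof. by move=> E f; exists (f m x). Qed.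

Definition fgen m (x : G m) : fcell false m := mk (gen_defined x).

Lemma val_gen E (f : graph_mor G (st_graph E)) m (x : G m) :
  val f (fgen x) = f m x.
Proof. by rewrite /fgen (@val_mk E f _ _ _ (gen_defined x) (f m x)). Qed.

Definition free_unit : graph_mor G (st_graph free_stretching).
Proof.
exists fgen => m x; apply: val_inj => E f.
- by rewrite val_src !val_gen gmap_src.
- by rewrite val_tgt !val_gen gmap_tgt.
Defined.

Definition free_ext (E : stretching n) (f : graph_mor G (st_graph E)) :
  stretching_mor free_stretching E.
Proof.
exists (valm f false) (valm f true).
- split; first exact: (valm_magma_mor f false).
  by move=> m p np h x; exact: (val_rev f np h x).
- exact: (valm_magma_mor f true).
- by apply: graph_mor_eq => m x /=; rewrite val_pi.
- by move=> m c1 c0 h e h' e'; exact: (val_br h e h' e').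
Defined.

Lemma free_extE E (f : graph_mor G (st_graph E)) m (x : G m) :
  valm f false m (free_unit m x) = f m x.
Proof. exact: val_gen. Qed.

Definition represents s m (t : term s m) (c : fcell s m) : Prop :=
  forall E (f : graph_mor G (st_graph E)), eval f t = Some (val f c).

Lemma represents_mk s m (t : term s m) (d : defined t) : represents t (mk d).
Proof. by move=> E f; have [x e] := d E f; rewrite (val_mk d e). Qed.

Lemma represents_omap s m s' m' (o : term s m -> term s' m')
  (oE : forall E, st_sort E s m -> st_sort E s' m') t c :
  (forall E (f : graph_mor G (st_graph E)),
     eval f (o t) = omap (oE E) (eval f t)) ->
  represents (o t) c ->
  exists c', represents t c' /\
    forall E (f : graph_mor G (st_graph E)), val f c = oE E (val f c').
Proof.
move=> H r.
have d : defined t.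
  move=> E f; move: (r E f); rewrite H.
  by case: (eval f t) => [x _|//]; exists x.
exists (mk d); split=> [|E f]; first exact: represents_mk.
by apply: Some_inj; rewrite -r H (represents_mk d).
Qed.

Lemma fparallel s m (c1 c0 : fgraph s m) :
  (forall E (f : graph_mor G (st_graph E)),
     parallel (valm f s m c1) (valm f s m c0)) -> parallel c1 c0.
Proof.
case: m c1 c0 => [//|m] c1 c0 H.
by split; apply: fgraph_inj => E f; have [] := H E f;
  rewrite ?gmap_src ?gmap_tgt.
Qed.

Section Unique.
Variables (E : stretching n) (g : stretching_mor free_stretching E).
Let f : graph_mor G (st_graph E) := graph_cmp (sm_fun g) free_unit.

Definition sort_mor s : graph_mor (fgraph s) (st_sort E s) :=
  if s return graph_mor (fgraph s) (st_sort E s) then sm_cat g else sm_fun g.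

Lemma sort_mor_magma s :
  is_magma_mor (fmagma s) (st_sort_magma E s) (sort_mor s).
Proof. by case: s; [exact (sm_cat_mor g)|have [] := sm_fun_mor g]. Qed.

Lemma sort_mor_rev s m p (np : n <= p) (h : p < m) (c : fgraph s m) :
  sort_mor s m (frev np h c)
  = reversor (st_sort_magma E s) np h (sort_mor s m c).
Proof.
case: s c => c; last by have [_ H] := sm_fun_mor g; exact: (H m p np h c).
apply: (inverse_unique (sc_strict (st_cat E))) (sc_invP np h _).
exact: is_magma_mor_inverse (sm_cat_mor g) (finv_inverse np h c).
Qed.

Lemma sort_mor_val s m (t : term s m) (c : fgraph s m) :
  represents t c -> sort_mor s m c = val f c.
Proof.
elim: t c => {s m}.
- move=> m x c r.
  have -> : c = free_unit m x.
    by apply: val_inj => E' f'; apply: Some_inj; rewrite -r [val _ _]free_extE.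
  by rewrite [RHS]free_extE.
- move=> s m t IH c r.
  have [c' [r' H]] := represents_omap (o := @tsrc s m) (oE := fun E' => @src (st_sort E' s) m)
    (fun _ _ => erefl) r.
  have -> : c = fsrc c' by apply: val_inj => E' f'; rewrite H val_src.
  rewrite val_src -IH //; exact: (gmap_src (sort_mor s) (c' : fgraph s m.+1)).
- move=> s m t IH c r.
  have [c' [r' H]] := represents_omap (o := @ttgt s m) (oE := fun E' => @tgt (st_sort E' s) m)
    (fun _ _ => erefl) r.
  have -> : c = ftgt c' by apply: val_inj => E' f'; rewrite H val_tgt.
  rewrite val_tgt -IH //; exact: (gmap_tgt (sort_mor s) (c' : fgraph s m.+1)).
- move=> s m t IH c r.
  have [c' [r' H]] := represents_omap (o := @trefl s m)
    (oE := fun E' => @reflexor _ (st_sort_magma E' s) m)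
    (fun _ _ => erefl) r.
  have -> : c = frefl c' by apply: val_inj => E' f'; rewrite H val_refl.
  by rewrite val_refl -IH //; have [H1 _] := sort_mor_magma s; exact: H1.
- move=> s m p np h t IH c r.
  have [c' [r' H]] := represents_omap (o := @trev s m p np h)
    (oE := fun E' => reversor (st_sort_magma E' s) np h)
    (fun _ _ => erefl) r.
  have -> : c = frev np h c' by apply: val_inj => E' f'; rewrite H val_rev.
  by rewrite val_rev -IH //; exact: sort_mor_rev.
- move=> s m p h ty IHy tx IHx c r.
  have dy : defined ty.
    move=> E' f'; move: (r E' f') => /=.
    by case: (eval f' ty) => [y _|//]; exists y.
  have dx : defined tx.
    move=> E' f'; move: (r E' f') => /=.
    by case: (eval f' ty) => [y|//]; case: (eval f' tx) => [x _|//]; exists x.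
  have ry := represents_mk dy; have rx := represents_mk dx.
  have e : composable (X := fgraph s) h (mk dy) (mk dx).
    apply: fgraph_inj => E' f'; rewrite gmap_srcn gmap_tgtn.
    by move: (r E' f'); rewrite /= ry rx; case: pselect.
  have -> : c = fcomp e.
    apply: val_inj => E' f'; apply: Some_inj; rewrite -r [val _ _]val_comp.
    exact: eval_comp.
  rewrite [RHS]val_comp; have [_ H] := sort_mor_magma s.
  rewrite [LHS](H _ _ _ _ _ e); apply: mcomp_congr; [exact: IHy|exact: IHx].
- move=> m t IH c r.
  have [c' [r' H]] := represents_omap (o := @tpi m) (oE := fun E' => @gmap _ _ (st_pi E') m)
    (fun _ _ => erefl) r.
  have -> : c = fpi c' by apply: val_inj => E' f'; rewrite H val_pi.
  rewrite val_pi -IH //; exact: (esym (sm_squareE g (c' : fgraph false m))).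
- move=> m t1 IH1 t0 IH0 c r.
  have d1 : defined t1.
    move=> E' f'; move: (r E' f') => /=.
    by case: (eval f' t1) => [y _|//]; exists y.
  have d0 : defined t0.
    move=> E' f'; move: (r E' f') => /=.
    by case: (eval f' t1) => [y|//]; case: (eval f' t0) => [x _|//]; exists x.
  have r1 := represents_mk d1; have r0 := represents_mk d0.
  have rb E' f' : parallel (val f' (mk d1) : st_graph E' m) (val f' (mk d0)) /\
      st_pi E' m (val f' (mk d1)) = st_pi E' m (val f' (mk d0)).
    move: (r E' f'); rewrite /= r1 r0.
    by case: pselect => [h|//]; case: pselect => [e|//].
  have h : parallel (X := fgraph false) (mk d1) (mk d0).
    by apply: fparallel => E' f'; have [] := rb E' f'.
  have e : fproj m (mk d1) = fproj m (mk d0).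
    apply: val_inj => E' f'; have [_ e] := rb E' f'.
    by rewrite [LHS]val_pi [RHS]val_pi.
  have -> : c = fbr h e.
    apply: val_inj => E' f'; apply: Some_inj; rewrite -r.
    have [h' [e' ->]] := val_br_ex f' h e; exact: eval_br.
  have [h' e'] := rb E f.
  rewrite (val_br h e h' e').
  have v1 : sm_fun g m (mk d1) = val f (mk d1) := IH1 _ r1.
  have v0 : sm_fun g m (mk d0) = val f (mk d0) := IH0 _ r0.
  have h2 : parallel (sm_fun g m (mk d1)) (sm_fun g m (mk d0)).
    by rewrite v1 v0.
  have e2 : st_pi E m (sm_fun g m (mk d1)) = st_pi E m (sm_fun g m (mk d0)).
    by rewrite v1 v0.
  transitivity (st_br E h2 e2); first exact
    (@sm_br n free_stretching E g m (mk d1) (mk d0) h e h2 e2).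
  exact: st_br_congr.
Qed.

Lemma free_ext_unique : free_ext f = g.
Proof.
by apply: stretching_mor_eq; apply: graph_mor_eq => m c /=; symmetry;
  [apply: (@sort_mor_val false m (rep c))|apply: (@sort_mor_val true m (rep c))];
  move=> E' f'; exact: eval_rep.
Qed.

End Unique.

End Free.
End FreeStretching.

Theorem forget_left_adjoint (n : nat) :
  exists F : functor graphCat (stretchingCat n),
    inhabited (adjunction F (forget n)).
Proof.
apply: (@FreeStretching.universal_adjunction graphCat (stretchingCat n)
  (forget n) (@FreeStretching.free_stretching n) (@FreeStretching.free_unit n)
  (fun G E f => FreeStretching.free_ext f)).
- by move=> G E f; apply: graph_mor_eq => m x; exact: FreeStretching.free_extE.
- by move=> G E g; exact: FreeStretching.free_ext_unique.
Qed.

(* Main.v *)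
Require Import Defs.
From mathcomp Require Import all_boot.

(** The unit law $v\lambda = \mathrm{id}$ makes [G] a retract of the graph of
    $M^n(G)$, and every operation transports along a retraction of graphs: lift
    the arguments by $\lambda$, operate, and come back by $v$. The positional
    axioms survive because $\lambda$ and $v$ commute with sources and targets
    ([retract_nmagma]).

    The associativity law makes $v$ a morphism. Both $\mu_G$ and $T^n(v)$
    underlie morphisms of stretchings, hence preserve all the operations
    ([mu_nmagma_mor], [fmap_nmagma_mor]), and $v\mu_G = v\,T^n(v)$. So, for an
    operation $\omega$ and a cell $x$ of $T^n(G)$,
    $$v(\omega(x)) = v(\omega(\mu\lambda x)) = v\mu(\omega(\lambda x))
      = v\,T^n(v)(\omega(\lambda x)) = v(\omega(T^n(v)\lambda x))
      = v(\omega(\lambda v x)),$$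
    and the last term is the transported operation applied to $v(x)$. This
    computation is [retract_nmagma_mor], stated for any split fork of graphs in
    place of $\mu_G$, $T^n(v)$, $v$ and the two units. *)

Set Implicit Arguments.
Unset Strict Implicit.
Unset Printing Implicit Defensive.

(** * Magma structures on retracts *)

Section Retract.
Variables (n : nat) (X G : graph) (M : nmagma_on n X).
Variables (v : graph_mor X G) (l : graph_mor G X).
Hypothesis vl : forall m (a : G m), v m (l m a) = a.

Definition retract_comp m p (h : p < m) (a b : G m) (e : composable h a b) :
  G m := v m (mcomp M (gmap_composable l e)).

Definition retract_refl : reflexive_on G.
Proof.
exists (fun m a => v m.+1 (reflexor M (l m a))) => m a.
- by rewrite -gmap_src src_reflexor vl.
- by rewrite -gmap_tgt tgt_reflexor vl.
Defined.

Definition retract_magma : magma_on G.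
Proof.
apply: (@MagmaOn _ retract_refl retract_comp).
- move=> m q p hpq hqm hpm a b e e'; rewrite /retract_comp -gmap_srcn.
  have e0 : composable hpq (srcn hqm (l m a)) (srcn hqm (l m b)).
    by rewrite -!gmap_srcn; exact: gmap_composable.
  by rewrite (srcn_mcomp_lt _ _ e0); congr (v _ _); apply: mcomp_congr;
    rewrite gmap_srcn.
- move=> m q p hpq hqm hpm a b e e'; rewrite /retract_comp -gmap_tgtn.
  have e0 : composable hpq (tgtn hqm (l m a)) (tgtn hqm (l m b)).
    by rewrite -!gmap_tgtn; exact: gmap_composable.
  by rewrite (tgtn_mcomp_lt _ _ e0); congr (v _ _); apply: mcomp_congr;
    rewrite gmap_tgtn.
- move=> m p q hqp hpm hqm a b e; rewrite /retract_comp -gmap_srcn.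
  by rewrite srcn_mcomp_ge // -gmap_srcn vl.
- move=> m p q hqp hpm hqm a b e; rewrite /retract_comp -gmap_tgtn.
  by rewrite tgtn_mcomp_ge // -gmap_tgtn vl.
Defined.

Definition retract_rev : reversible_on n G.
Proof.
exists (fun m p np h a => v m (reversor M np h (l m a))).
- by move=> p np h a; rewrite -gmap_src src_reversor1 gmap_tgt vl.
- by move=> p np h a; rewrite -gmap_tgt tgt_reversor1 gmap_src vl.
- by move=> m p np h hS a; rewrite -gmap_src (src_reversor _ _ h) -gmap_src.
- by move=> m p np h hS a; rewrite -gmap_tgt (tgt_reversor _ _ h) -gmap_tgt.
Defined.

Definition retract_nmagma : nmagma_on n G := NMagmaOn retract_magma retract_rev.

(** In a split fork whose parallel pair preserves the operations, the
    identifications made by [v] form a congruence: an operation applied to [x]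
    is the image under [f] of the same operation applied to [k x], [v] allows
    [f] to be replaced by [g], and [g] turns [k x] into the canonical
    representative [l (v x)]. *)
Lemma retract_nmagma_mor (Y : graph) (N : nmagma_on n Y)
  (f g : graph_mor Y X) (k : graph_mor X Y) :
  is_nmagma_mor N M f -> is_nmagma_mor N M g ->
  (forall m (y : Y m), v m (f m y) = v m (g m y)) ->
  (forall m (x : X m), f m (k m x) = x) ->
  (forall m (x : X m), g m (k m x) = l m (v m x)) ->
  is_nmagma_mor M retract_nmagma v.
Proof.
move=> [[f_refl f_comp] f_rev] [[g_refl g_comp] g_rev] vfg fk gk.
split; first split.
- move=> m x; rewrite [RHS]/= -gk -g_refl -vfg f_refl; congr (v _ (reflexor _ _)).
  by rewrite fk.
- move=> m p h y x e; rewrite [RHS]/= /retract_comp.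
  transitivity (v m (f m (mcomp N (gmap_composable k e)))).
    by rewrite f_comp; congr (v _ _); apply: mcomp_congr; rewrite fk.
  by rewrite vfg g_comp; congr (v _ _); apply: mcomp_congr; rewrite gk.
- by move=> m p np h x; rewrite [RHS]/= -gk -g_rev -vfg f_rev fk.
Qed.

End Retract.

(** * The multiplication and the functor preserve the magma operations *)

Section Monad.
Variables (n : nat) (F : functor graphCat (stretchingCat n)).
Variables (adj : adjunction F (forget n)).
Let T := adj_monad adj.
Let magma (G : graph) : nmagma_on n (T G) := st_magma (F G).

Lemma mu_nmagma_mor (G : graph) :
  is_nmagma_mor (magma (T G)) (magma G) (monad_mu T G).
Proof. exact: sm_fun_mor (adj_counit adj (F G)). Qed.

Lemma fmap_nmagma_mor (G H : graph) (u : graph_mor G H) :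
  is_nmagma_mor (magma G) (magma H) (@fmap _ _ T G H u).
Proof. exact: sm_fun_mor (@fmap _ _ F G H u). Qed.

End Monad.

Theorem mainTheorem4 (n : nat)
  (F : functor graphCat (stretchingCat n)) (adj : adjunction F (forget n))
  (G : graph) (v : graph_mor (adj_monad adj G) G)
  (hv : @is_algebra graphCat (adj_monad adj) G v) :
  let M : nmagma_on n (adj_monad adj G) := st_magma (F G) in
  let lambda : graph_mor G (adj_monad adj G) := monad_eta (adj_monad adj) G in
  exists A : nmagma_on n G,
    [/\ forall m p (h : p < m) (a b : G m) (e : composable h a b),
          mcomp A e = v m (mcomp M (gmap_composable lambda e)),
        forall m p (h : p < m) (a : G p),
          reflexorn A h a = v m (reflexorn M h (lambda p a)),
        forall m p (np : n <= p) (h : p < m) (a : G m),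
          reversor A np h a = v m (reversor M np h (lambda m a))
      & is_nmagma_mor M A v].
Proof.
move=> M lambda; case: hv => v_eta v_mu.
have ptwise (X Y : graph) (f g : graph_mor X Y) : f = g ->
    forall m (x : X m), f m x = g m x by move=> ->.
have vl : forall m (a : G m), v m (lambda m a) = a := ptwise _ _ _ _ v_eta.
have v_mor : is_nmagma_mor M (retract_nmagma M vl) v.
  apply: (retract_nmagma_mor vl (mu_nmagma_mor adj G) (fmap_nmagma_mor adj v)
    (k := monad_eta (adj_monad adj) (adj_monad adj G))).
  - exact: ptwise v_mu.
  - exact: ptwise (monad_mu_etal (adj_monad adj) G).
  - move=> m x.
    exact: esym (ptwise _ _ _ _ (@monad_eta_natural _ (adj_monad adj) _ _ v) m x).
exists (retract_nmagma M vl); split => //.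
(* Only one-step reflexors were transported; the iterated ones follow, since
   [v] preserves them and [v] retracts [lambda]. *)
move=> m p h a; have [v_magma _] := v_mor.
by rewrite (FreeStretching.gmap_reflexorn v_magma) vl.
Qed.
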